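(* Let $a<b$, let $\alpha\in C^1([a,b],\,]0,1[)$, fix $n\in\mathbb{N}$ and an integer $N\ge n+1$, and let $x\in C^{n+1}([a,b],\mathbb{R})$. For $t\in\,]a,b]$ and $k\ge n+1$ let $V_k(t)=(k-n)\int_a^t(\tau-a)^{k-n-1}x(\tau)\,d\tau$, and define $$A(\alpha(t),k)=\frac{1}{\Gamma(k+1+\alpha(t))}\Big[1+\sum_{p=n+1-k}^{N}\frac{\Gamma(p-n-\alpha(t))}{\Gamma(-\alpha(t)-k)(p-n+k)!}\Big],\quad k=0,\dots,n,$$ $$B(\alpha(t),k)=\frac{\Gamma(k-n-\alpha(t))}{\Gamma(\alpha(t))\Gamma(1-\alpha(t))(k-n)!},\quad k\ge n+1.$$ Then for every $t\in\,]a,b]$, $${}_aI_t^{\alpha(t)}x(t)=(t-a)^{\alpha(t)}\Big[\sum_{k=0}^nA(\alpha(t),k)(t-a)^kx^{(k)}(t)+\sum_{k=n+1}^NB(\alpha(t),k)(t-a)^{n-k}V_k(t)\Big]+E_N(t),$$ where $$|E_N(t)|\le L_{n+1}(t)\frac{\exp\big((n+\alpha(t))^2+n+\alpha(t)\big)}{\Gamma(n+1+\alpha(t))(n+\alpha(t))N^{n+\alpha(t)}}(t-a)^{n+1+\alpha(t)},\qquad L_{n+1}(t)=\max_{\tau\in[a,t]}|x^{(n+1)}(\tau)|.$$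
   Context: For a function $\alpha:[a,b]\to\,]0,1[$ and $t\in[a,b]$, the left Riemann–Liouville fractional integral of variable order $\alpha(\cdot)$ is $${}_aI_t^{\alpha(t)}x(t)=\frac{1}{\Gamma(\alpha(t))}\int_a^t(t-\tau)^{\alpha(t)-1}x(\tau)\,d\tau.$$ *)

(* Defs.v *)
From Stdlib Require Import Reals Rprod Lra ClassicalEpsilon Factorial ZArith.
Open Scope R_scope.

(* Gamma function, defined for all reals x that are not non-positive integers
   by Gauss/Euler's limit formula
     Gamma x = lim_{m->oo} m! m^x / (x (x+1) ... (x+m)). *)
Definition gamma_seq (x : R) (m : nat) : R :=
  INR (fact m) * Rpower (INR m) x / prod_f_R0 (fun i => x + INR i) m.

Definition Gamma (x : R) : R :=
  epsilon (inhabits 0) (fun l => Un_cv (gamma_seq x) l).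

(* Riemann integral of f on [a,b] (a value; meaningful when f is integrable). *)
Definition Rint (f : R -> R) (a b : R) : R :=
  epsilon (inhabits 0)
    (fun l => exists pr : Riemann_integrable f a b, RiemannInt pr = l).

Definition improper_int_limit (f : R -> R) (a t l : R) : Prop :=
  forall eps, 0 < eps -> exists delta, 0 < delta /\
    forall s, a < s < t -> t - delta < s ->
      exists pr : Riemann_integrable f a s, Rabs (RiemannInt pr - l) < eps.

Definition improper_int (f : R -> R) (a t : R) : R :=
  epsilon (inhabits 0) (fun l => improper_int_limit f a t l).

Definition RL_int (alpha x : R -> R) (a t : R) : R :=
  / Gamma (alpha t) *
  improper_int (fun tau => Rpower (t - tau) (alpha t - 1) * x tau) a t.

Definition deriv_within (a b : R) (f : R -> R) (tau l : R) : Prop :=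
  forall eps, 0 < eps -> exists delta, 0 < delta /\
    forall h, h <> 0 -> Rabs h < delta -> a <= tau + h <= b ->
      Rabs ((f (tau + h) - f tau) / h - l) < eps.

Definition cont_within (a b : R) (f : R -> R) (tau : R) : Prop :=
  forall eps, 0 < eps -> exists delta, 0 < delta /\
    forall s, Rabs (s - tau) < delta -> a <= s <= b ->
      Rabs (f s - f tau) < eps.

Definition Cm_derivs (a b : R) (m : nat) (x : R -> R) (D : nat -> R -> R) : Prop :=
  (forall tau, a <= tau <= b -> D 0%nat tau = x tau) /\
  (forall k tau, (k < m)%nat -> a <= tau <= b ->
      deriv_within a b (D k) tau (D (S k) tau)) /\
  (forall tau, a <= tau <= b -> cont_within a b (D m) tau).

Definition max_abs_on (f : R -> R) (a t : R) : R :=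
  epsilon (inhabits 0)
    (fun l => is_lub (fun y => exists tau, a <= tau <= t /\ y = Rabs (f tau)) l).

Definition V (x : R -> R) (a : R) (n k : nat) (t : R) : R :=
  INR (k - n) * Rint (fun tau => (tau - a) ^ (k - n - 1) * x tau) a t.

(* A(alpha,k), k = 0..n, with the inner sum over integers p = n+1-k .. N,
   written p = n+1-k+j, j = 0 .. N+k-n-1, so (p-n+k)! = (j+1)!. *)
Definition coefA (al : R) (n N k : nat) : R :=
  / Gamma (INR k + 1 + al) *
  (1 + sum_f_R0 (fun j =>
        let p := (Z.of_nat (n + 1) - Z.of_nat k + Z.of_nat j)%Z in
        Gamma (IZR p - INR n - al) /
        (Gamma (- al - INR k) * INR (fact (Z.to_nat (p - Z.of_nat n + Z.of_nat k)))))
      (N + k - n - 1)).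

Definition coefB (al : R) (n k : nat) : R :=
  Gamma (INR k - INR n - al) /
  (Gamma al * Gamma (1 - al) * INR (fact (k - n))).

(* Main.v *)
Require Import Defs.
From Stdlib Require Import Reals Rprod Factorial ZArith.
From Stdlib Require Import Lra Lia ClassicalEpsilon.
From Coquelicot Require Import Coquelicot.
Open Scope R_scope.

(* Put T = t - a, u = (tau - a)/T and al = alpha(t), and let S_(b,m)(u) be the remainder of
   the binomial series of (1 - u)^b after degree m.  The B-terms are exactly what is
   subtracted from the fractional integral when its kernel T^(al-1) (1 - u)^(al-1) is
   replaced by the remainder with b = al - 1 and m = N - n - 1.  Since
   S_(b+1,m+1)' = - (b+1) S_(b,m) and S(0) = 0, integrating by parts n + 1 times produces
   boundary terms at t only, and these are the A-terms; the error is therefore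
   T^(n+al) / Gamma(n+1+al) times the integral of S_(n+al,N) x^(n+1).

   Descending to a negative exponent shows that (-1)^(n+1) S_(n+al,N) is nonnegative and
   nondecreasing on [0,1), so it is at most its limit at 1, whose absolute value is
   |C(n+al-1, N)|.  With b = n + al, the sequence |C(b,p)| p^(b+1) decreases for p > n by
   Bernoulli's inequality, and at p = n + 1 it is at most (n+1)^(b+1) <= exp (b^2 + b). *)

(** * The Gamma function *)

Lemma Rpower_pos (y r : R) : 0 < Rpower y r.
Proof. apply exp_pos. Qed.

(** Serves with [y = m/(m+1)] to make [gamma_seq] increase and with [y = (m+2)/(m+1)] to bound
    it. *)
Lemma Rpower_bernoulli_concave (y r : R) :
  0 < y -> 0 <= r <= 1 -> Rpower y r <= 1 + r * (y - 1).
Proof.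
  intros Hy Hr.
  set (u := ln y).
  assert (Ey : y = exp u) by (unfold u; now rewrite exp_ln).
  unfold Rpower; fold u; rewrite Ey.
  set (c := r * u).
  (* The tangent line of exp at c lies below exp at u and at 0. *)
  assert (H1 : exp c * (1 + (u - c)) <= exp u).
  { replace (exp u) with (exp c * exp (u - c)) by (rewrite <- exp_plus; f_equal; ring).
    apply Rmult_le_compat_l; [left; apply exp_pos | apply exp_ineq1_le]. }
  assert (H2 : exp c * (1 + - c) <= 1).
  { replace 1 with (exp c * exp (- c)) at 2
      by (rewrite <- exp_plus, <- exp_0; f_equal; ring).
    apply Rmult_le_compat_l; [left; apply exp_pos | apply exp_ineq1_le]. }
  assert (H3 : r * (exp c * (1 + (u - c))) <= r * exp u)
    by (apply Rmult_le_compat_l; lra).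
  assert (H4 : (1 - r) * (exp c * (1 + - c)) <= (1 - r) * 1)
    by (apply Rmult_le_compat_l; lra).
  assert (H5 : r * (exp c * (1 + (u - c))) + (1 - r) * (exp c * (1 + - c)) = exp c)
    by (unfold c; ring).
  lra.
Qed.

(** This is the concave case for the base [Rpower y r] and the exponent [/ r], solved for
    [Rpower y r]. *)
Lemma Rpower_bernoulli_convex (y r : R) :
  0 < y -> 1 <= r -> 1 + r * (y - 1) <= Rpower y r.
Proof.
  intros Hy Hr.
  assert (Hi : 0 <= / r <= 1).
  { split; [left; apply Rinv_0_lt_compat; lra|].
    rewrite <- Rinv_1; apply Rinv_le_contravar; lra. }
  pose proof (Rpower_bernoulli_concave (Rpower y r) (/ r) (Rpower_pos _ _) Hi) as H.
  rewrite Rpower_mult, Rinv_r, Rpower_1 in H by lra.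
  apply (Rmult_le_compat_l r) in H; [|lra].
  replace (r * (1 + / r * (Rpower y r - 1))) with (r + (Rpower y r - 1)) in H
    by (field; lra).
  lra.
Qed.

(** Limits are unique, so the choice made by [epsilon] is forced as soon as some limit exists. *)
Lemma Un_cv_gamma_seq (x l : R) : Un_cv (gamma_seq x) l -> Gamma x = l.
Proof.
  intros H; unfold Gamma.
  apply (UL_sequence (gamma_seq x)); [|exact H].
  apply epsilon_spec; now exists l.
Qed.

Definition nonpole (x : R) : Prop := forall m : nat, x + INR m <> 0.

Lemma prod_nonpole (x : R) (m : nat) :
  nonpole x -> prod_f_R0 (fun i => x + INR i) m <> 0.
Proof.
  intros H; induction m as [|m IH]; cbn [prod_f_R0]; [apply H|].
  apply Rmult_integral_contrapositive; split; [exact IH | apply H].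
Qed.

(** Both sides are the product of [x + i] for i from 0 to m + 1. *)
Lemma prod_shift (x : R) (m : nat) :
  prod_f_R0 (fun i => x + 1 + INR i) m * x =
  prod_f_R0 (fun i => x + INR i) m * (x + 1 + INR m).
Proof.
  induction m as [|m IH]; cbn [prod_f_R0]; [simpl; ring|].
  rewrite S_INR in *.
  transitivity (prod_f_R0 (fun i => x + 1 + INR i) m * x * (x + 1 + (INR m + 1)));
    [ring | rewrite IH; ring].
Qed.

Lemma nonpole_succ (x : R) : nonpole x -> nonpole (x + 1).
Proof.
  intros H m; specialize (H (S m)); rewrite S_INR in H; lra.
Qed.

Lemma nonpole_pos (x : R) : 0 < x -> nonpole x.
Proof. intros H m; pose proof (pos_INR m); lra. Qed.

(** The functional equation of Gamma holds at each finite [m] up to a factor that tends to 1. *)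
Lemma gamma_seq_succ (x : R) (m : nat) : (1 <= m)%nat -> nonpole x ->
  gamma_seq (x + 1) m = x * gamma_seq x m * (INR m / (INR m + (x + 1))).
Proof.
  intros Hm Hx; unfold gamma_seq.
  assert (H0 : 0 < INR m) by (apply lt_0_INR; lia).
  rewrite Rpower_plus, Rpower_1 by exact H0.
  pose proof (prod_nonpole x m Hx) as H1.
  pose proof (prod_nonpole (x + 1) m (nonpole_succ x Hx)) as H2.
  pose proof (prod_shift x m) as H3.
  assert (Hx0 : x <> 0) by (specialize (Hx 0%nat); simpl in Hx; lra).
  assert (Hxm : INR m + (x + 1) <> 0)
    by (specialize (Hx (S m)); rewrite S_INR in Hx; lra).
  assert (H4 : prod_f_R0 (fun i => x + 1 + INR i) m =
    prod_f_R0 (fun i => x + INR i) m * (INR m + (x + 1)) / x).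
  { apply (Rmult_eq_reg_r x); [|exact Hx0]. rewrite H3; field; exact Hx0. }
  rewrite H4; field; repeat split; assumption.
Qed.

Lemma lim_INR_ratio (y : R) : is_lim_seq (fun m => INR m / (INR m + y)) 1.
Proof.
  (* Shifting the index by some k > |y| keeps the denominator positive even when [y] is negative. *)
  apply (is_lim_seq_incr_n _ (Z.to_nat (up (Rabs y)))).
  set (k := Z.to_nat (up (Rabs y))).
  assert (Hk : Rabs y < INR k).
  { unfold k; destruct (archimed (Rabs y)) as [H _].
    rewrite INR_IZR_INZ, Z2Nat.id; [lra|].
    apply le_IZR; pose proof (Rabs_pos y); lra. }
  apply Rabs_def2 in Hk.
  apply (is_lim_seq_ext (fun m => 1 - y * / (INR m + (INR k + y)))).
  { intros m; rewrite plus_INR; pose proof (pos_INR m); field; lra. }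
  replace (Finite 1) with (Rbar_minus 1 (Rbar_mult y 0)) by (simpl; f_equal; ring).
  apply is_lim_seq_minus'; [apply is_lim_seq_const|].
  apply (is_lim_seq_scal_l _ y 0).
  apply (is_lim_seq_inv _ p_infty); [|easy].
  apply (is_lim_seq_plus _ _ p_infty (INR k + y));
    [apply is_lim_seq_INR | apply is_lim_seq_const | easy].
Qed.

(** The condition [l <> 0] is carried along the recurrences because values of Gamma occur in
    denominators. *)
Definition gamma_cv (x l : R) : Prop := Un_cv (gamma_seq x) l /\ l <> 0.

Lemma gamma_cv_succ (x l : R) :
  nonpole x -> gamma_cv x l -> gamma_cv (x + 1) (x * l).
Proof.
  intros Hx [Hl Hl0].
  assert (Hx0 : x <> 0) by (specialize (Hx 0%nat); simpl in Hx; lra).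
  split; [|now apply Rmult_integral_contrapositive].
  apply is_lim_seq_Reals.
  apply (is_lim_seq_ext_loc
    (fun m => x * gamma_seq x m * (INR m / (INR m + (x + 1))))).
  { exists 1%nat; intros m Hm; symmetry; now apply gamma_seq_succ. }
  replace (x * l) with (x * l * 1) by ring.
  apply is_lim_seq_mult'; [|apply lim_INR_ratio].
  apply (is_lim_seq_scal_l _ x l); now apply is_lim_seq_Reals.
Qed.

Lemma gamma_cv_pred (x l : R) :
  nonpole x -> gamma_cv (x + 1) l -> gamma_cv x (l / x).
Proof.
  intros Hx [Hl Hl0].
  assert (Hx0 : x <> 0) by (specialize (Hx 0%nat); simpl in Hx; lra).
  split; [|now apply Rmult_integral_contrapositive; split;
            [|apply Rinv_neq_0_compat]].
  apply is_lim_seq_Reals.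
  apply (is_lim_seq_ext_loc
    (fun m => gamma_seq (x + 1) m * (/ x * / (INR m / (INR m + (x + 1)))))).
  { exists 1%nat; intros m Hm; rewrite gamma_seq_succ by assumption.
    assert (0 < INR m) by (apply lt_0_INR; lia).
    assert (INR m + (x + 1) <> 0)
      by (specialize (Hx (S m)); rewrite S_INR in Hx; lra).
    field; repeat split; lra. }
  unfold Rdiv at 1; apply is_lim_seq_mult'; [now apply is_lim_seq_Reals|].
  replace (/ x) with (/ x * / 1) at 1 by (field; exact Hx0).
  apply (is_lim_seq_scal_l _ (/ x) (/ 1)).
  apply (is_lim_seq_inv _ 1); [apply lim_INR_ratio|].
  intros H; injection H; lra.
Qed.

Lemma gamma_seq_step (x : R) (m : nat) : (1 <= m)%nat -> 0 < x ->
  gamma_seq x (S m) =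
  gamma_seq x m * ((INR m + 1) / (x + (INR m + 1)) * / Rpower (INR m / (INR m + 1)) x).
Proof.
  intros Hm Hx.
  assert (H0 : 0 < INR m) by (apply lt_0_INR; lia).
  assert (HR : Rpower (INR m) x = Rpower (INR m / (INR m + 1)) x * Rpower (INR m + 1) x).
  { rewrite Rpower_mult_distr;
      [f_equal; field; lra | apply Rdiv_lt_0_compat; lra | lra]. }
  unfold gamma_seq; rewrite HR; cbn [prod_f_R0].
  rewrite fact_simpl, mult_INR, S_INR.
  pose proof (prod_nonpole x m (nonpole_pos x Hx)).
  pose proof (Rpower_pos (INR m / (INR m + 1)) x).
  field; repeat split; lra.
Qed.

Lemma gamma_seq_pos (x : R) (m : nat) : 0 < x -> 0 < gamma_seq x m.
Proof.
  intros Hx; unfold gamma_seq.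
  apply Rdiv_lt_0_compat.
  - apply Rmult_lt_0_compat; [apply INR_fact_lt_0 | apply Rpower_pos].
  - induction m as [|m IH]; cbn [prod_f_R0]; [simpl; lra|].
    apply Rmult_lt_0_compat; [exact IH|]. pose proof (pos_INR (S m)); lra.
Qed.

Lemma gamma_seq_growing (x : R) (m : nat) : (1 <= m)%nat -> 0 < x < 1 ->
  gamma_seq x m <= gamma_seq x (S m).
Proof.
  intros Hm Hx.
  assert (H0 : 0 < INR m) by (apply lt_0_INR; lia).
  rewrite gamma_seq_step by (assumption || lra).
  rewrite <- (Rmult_1_r (gamma_seq x m)) at 1.
  apply Rmult_le_compat_l; [left; apply gamma_seq_pos; lra|].
  set (y := INR m / (INR m + 1)).
  assert (Hy : 0 < y) by (apply Rdiv_lt_0_compat; lra).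
  pose proof (Rpower_bernoulli_concave y x Hy ltac:(lra)) as HB.
  pose proof (Rpower_pos y x) as HP.
  apply (Rmult_le_reg_r (Rpower y x)); [exact HP|].
  rewrite Rmult_assoc, Rinv_l, Rmult_1_l, Rmult_1_r by lra.
  eapply Rle_trans; [exact HB|].
  unfold y.
  assert (HE : (INR m + 1) / (x + (INR m + 1)) - (1 + x * (INR m / (INR m + 1) - 1)) =
    x * x / ((x + (INR m + 1)) * (INR m + 1))) by (field; lra).
  assert (0 <= x * x / ((x + (INR m + 1)) * (INR m + 1))).
  { apply Rdiv_le_0_compat; [nra|]. apply Rmult_lt_0_compat; lra. }
  lra.
Qed.

(** With m + 1 as the base of the power the induction closes: each step is Bernoulli's inequality at
    (m+2)/(m+1). Since m^x <= (m+1)^x, it bounds [gamma_seq x m] by 1/x. *)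
Lemma gamma_seq_bound (x : R) (m : nat) : 0 < x < 1 ->
  INR (fact m) * Rpower (INR m + 1) x * x <= prod_f_R0 (fun i => x + INR i) m.
Proof.
  intros Hx; induction m as [|m IH]; cbn [prod_f_R0].
  - simpl. rewrite Rplus_0_l. unfold Rpower; rewrite ln_1, Rmult_0_r, exp_0. lra.
  - pose proof (pos_INR m) as Hm.
    rewrite fact_simpl, mult_INR, S_INR.
    set (y := (INR m + 1 + 1) / (INR m + 1)).
    assert (Hy : 0 < y) by (apply Rdiv_lt_0_compat; lra).
    assert (HR : Rpower (INR m + 1 + 1) x = Rpower (INR m + 1) x * Rpower y x).
    { rewrite Rpower_mult_distr by (lra || assumption); f_equal; unfold y; field; lra. }
    rewrite HR.
    pose proof (Rpower_bernoulli_concave y x Hy ltac:(lra)) as HB.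
    replace (1 + x * (y - 1)) with ((x + (INR m + 1)) / (INR m + 1)) in HB
      by (unfold y; field; lra).
    apply (Rmult_le_compat_l (INR m + 1)) in HB; [|lra].
    replace ((INR m + 1) * ((x + (INR m + 1)) / (INR m + 1))) with (x + (INR m + 1)) in HB
      by (field; lra).
    replace ((INR m + 1) * INR (fact m) * (Rpower (INR m + 1) x * Rpower y x) * x)
      with (INR (fact m) * Rpower (INR m + 1) x * x * ((INR m + 1) * Rpower y x)) by ring.
    pose proof (INR_fact_lt_0 m); pose proof (Rpower_pos (INR m + 1) x);
      pose proof (Rpower_pos y x).
    apply Rmult_le_compat; [| |exact IH|exact HB].
    + apply Rmult_le_pos; [|lra]; apply Rmult_le_pos; lra.
    + apply Rmult_le_pos; lra.
Qed.

Lemma gamma_cv_unit (x : R) : 0 < x < 1 -> exists l, gamma_cv x l /\ 0 < l.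
Proof.
  intros Hx.
  (* The index starts at 1, because at m = 0 the power [Rpower (INR 0) x] is only a default
     value. *)
  destruct (growing_cv (fun m => gamma_seq x (S m))) as [l Hl].
  - intros m; apply gamma_seq_growing; [lia | exact Hx].
  - exists (/ x); intros y [m ->].
    pose proof (gamma_seq_bound x (S m) Hx) as HB.
    unfold gamma_seq.
    assert (HP : 0 < prod_f_R0 (fun i => x + INR i) (S m)).
    { eapply Rlt_le_trans; [|exact HB].
      pose proof (INR_fact_lt_0 (S m)); pose proof (Rpower_pos (INR (S m) + 1) x).
      apply Rmult_lt_0_compat; [apply Rmult_lt_0_compat|]; lra. }
    apply (Rmult_le_reg_r (prod_f_R0 (fun i => x + INR i) (S m))); [exact HP|].
    unfold Rdiv; rewrite Rmult_assoc, Rinv_l, Rmult_1_r by lra.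
    apply (Rmult_le_reg_r x); [lra|].
    rewrite (Rmult_comm (/ x)), (Rmult_assoc _ (/ x)), Rinv_l, Rmult_1_r by lra.
    eapply Rle_trans; [|exact HB].
    apply Rmult_le_compat_r; [lra|].
    apply Rmult_le_compat_l; [apply pos_INR|].
    apply Rle_Rpower_l; [lra|].
    split; [apply lt_0_INR; lia | lra].
  - assert (Hcv : Un_cv (gamma_seq x) l).
    { apply is_lim_seq_Reals, is_lim_seq_incr_1, is_lim_seq_Reals; exact Hl. }
    assert (Hpos : 0 < l).
    { apply Rlt_le_trans with (gamma_seq x 1); [apply gamma_seq_pos; lra|].
      apply (growing_ineq (fun m => gamma_seq x (S m)) l) with (n := 0%nat); [|exact Hl].
      intros m; apply gamma_seq_growing; [lia | exact Hx]. }
    exists l; repeat split; [exact Hcv| lra | exact Hpos].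
Qed.

Definition gamma_ok (x : R) : Prop := nonpole x /\ exists l, gamma_cv x l.

Lemma Gamma_neq_0 (x : R) : gamma_ok x -> Gamma x <> 0.
Proof. intros [_ [l [Hl Hl0]]]; now rewrite (Un_cv_gamma_seq x l Hl). Qed.

Lemma Gamma_succ (x : R) : gamma_ok x -> Gamma (x + 1) = x * Gamma x.
Proof.
  intros [Hx [l Hl]].
  rewrite (Un_cv_gamma_seq x l (proj1 Hl)).
  apply Un_cv_gamma_seq, (gamma_cv_succ x l Hx Hl).
Qed.

Lemma gamma_ok_succ (x : R) : gamma_ok x -> gamma_ok (x + 1).
Proof.
  intros [Hx [l Hl]]; split; [now apply nonpole_succ|].
  exists (x * l); now apply gamma_cv_succ.
Qed.

Lemma gamma_ok_unit (x : R) : 0 < x < 1 -> gamma_ok x.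
Proof.
  intros Hx; split; [apply nonpole_pos; lra|].
  destruct (gamma_cv_unit x Hx) as [l [Hl _]]; now exists l.
Qed.

Lemma Gamma_pos_unit_shift (al : R) (k : nat) : 0 < al < 1 ->
  gamma_ok (al + INR k) /\ 0 < Gamma (al + INR k).
Proof.
  intros Hal; induction k as [|k [IH1 IH2]].
  - simpl; rewrite Rplus_0_r; split; [now apply gamma_ok_unit|].
    destruct (gamma_cv_unit al Hal) as [l [Hl Hp]].
    now rewrite (Un_cv_gamma_seq al l (proj1 Hl)).
  - rewrite S_INR, <- Rplus_assoc; split; [now apply gamma_ok_succ|].
    rewrite Gamma_succ by assumption.
    apply Rmult_lt_0_compat; [pose proof (pos_INR k); lra | exact IH2].
Qed.

(** Starting from 1 - al in (0,1), the backward recurrence descends one unit at a time; no pole is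
    met because [al] lies strictly between consecutive integers. *)
Lemma gamma_ok_neg_shift (al : R) (k : nat) : 0 < al < 1 -> gamma_ok (- al - INR k).
Proof.
  intros Hal.
  assert (HN : forall k, nonpole (- al - INR k)).
  { intros j m.
    destruct (le_lt_dec m j) as [H|H].
    - apply le_INR in H; lra.
    - apply (le_INR (S j) m) in H; rewrite S_INR in H; lra. }
  induction k as [|k IH]; (split; [apply HN|]).
  - destruct (gamma_cv_unit (1 - al) ltac:(lra)) as [l [Hl _]].
    eexists; apply gamma_cv_pred; [apply HN|].
    replace (- al - INR 0 + 1) with (1 - al) by (simpl; ring); exact Hl.
  - destruct IH as [_ [l Hl]].
    eexists; apply gamma_cv_pred; [apply HN|].
    replace (- al - INR (S k) + 1) with (- al - INR k) by (rewrite S_INR; ring); exact Hl.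
Qed.

(** * Binomial series *)

(* The coefficient of u^p in the binomial series of (1 - u)^b. *)
Fixpoint binc (b : R) (p : nat) : R :=
  match p with
  | O => 1
  | S q => binc b q * ((INR q - b) / INR (S q))
  end.

(** This is the bridge from the Gamma quotients in [coefA] and [coefB] to binomial coefficients; it
    iterates the functional equation. *)
Lemma Gamma_binc (b : R) (p : nat) : gamma_ok (- b) ->
  gamma_ok (INR p - b) /\ Gamma (INR p - b) = binc b p * INR (fact p) * Gamma (- b).
Proof.
  intros Hb; induction p as [|p [IH1 IH2]].
  - simpl; replace (0 - b) with (- b) by ring; split; [exact Hb | ring].
  - replace (INR (S p) - b) with (INR p - b + 1) by (rewrite S_INR; ring).
    split; [now apply gamma_ok_succ|].
    rewrite Gamma_succ, IH2 by assumption.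
    cbn [binc]; rewrite fact_simpl, mult_INR.
    field; apply not_0_INR; lia.
Qed.

(** Coefficient form of the rule that (1-u)^(b+1) has derivative -(b+1) (1-u)^b. *)
Lemma binc_succ_order (b : R) (p : nat) :
  INR (S p) * binc (b + 1) (S p) = - (b + 1) * binc b p.
Proof.
  induction p as [|p IH]; [simpl; field|].
  change (binc (b + 1) (S (S p))) with
    (binc (b + 1) (S p) * ((INR (S p) - (b + 1)) / INR (S (S p)))).
  change (binc b (S p)) with (binc b p * ((INR p - b) / INR (S p))).
  assert (HS : INR (S p) <> 0) by (apply not_0_INR; lia).
  assert (HSS : INR (S (S p)) <> 0) by (apply not_0_INR; lia).
  replace (binc (b + 1) (S p)) with (- (b + 1) * binc b p / INR (S p))
    by (rewrite <- IH; field; exact HS).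
  replace (INR (S p) - (b + 1)) with (INR p - b) by (rewrite S_INR; ring).
  field; split; assumption.
Qed.

(** Coefficient form of the identity b (1-u)^(b-1) = b f - u f' for f = (1-u)^b. *)
Lemma binc_pred_order (b : R) (p : nat) :
  b * binc (b - 1) p = (b - INR p) * binc b p.
Proof.
  induction p as [|p IH]; [simpl; ring|].
  cbn [binc].
  rewrite <- Rmult_assoc, IH, S_INR.
  pose proof (pos_INR p); field; lra.
Qed.

(** Dividing a power series by 1 - u replaces its coefficients by their partial sums. *)
Lemma sum_binc (b : R) (m : nat) : b <> 0 -> sum_f_R0 (binc b) m = binc (b - 1) m.
Proof.
  intros Hb; induction m as [|m IH]; [reflexivity|].
  cbn [sum_f_R0]; rewrite IH.
  apply (Rmult_eq_reg_l b); [|exact Hb].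
  rewrite Rmult_plus_distr_l, !binc_pred_order.
  cbn [binc]; rewrite S_INR; pose proof (pos_INR m); field; lra.
Qed.

(** Up to sign, [binc] times p! is the product of n + al - i over i < p, and each factor is at most
    n + 1 - i. The case p = n + 1 shows that the coefficient there is at most 1 in absolute
    value. *)
Lemma binc_fact_le (n : nat) (al : R) : 0 < al < 1 ->
  forall p, (p <= n + 1)%nat ->
  Rabs (binc (INR n + al) p) * INR (fact p) * INR (fact (n + 1 - p)) <= INR (fact (n + 1)).
Proof.
  intros Hal p; induction p as [|p IH]; intros Hp.
  - rewrite Nat.sub_0_r; simpl (fact 0); simpl (binc _ 0).
    rewrite Rabs_R1; simpl (INR 1); lra.
  - specialize (IH ltac:(lia)).
    assert (HSp : 0 < INR (S p)) by (apply lt_0_INR; lia).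
    replace (n + 1 - p)%nat with (S (n + 1 - S p)) in IH by lia.
    rewrite fact_simpl, mult_INR in IH.
    replace (INR (S (n + 1 - S p))) with (INR n + 1 - INR p) in IH
      by (replace (S (n + 1 - S p)) with (n + 1 - p)%nat by lia;
          rewrite minus_INR, plus_INR by lia; simpl; ring).
    cbn [binc]; rewrite (fact_simpl p), mult_INR, Rabs_mult.
    unfold Rdiv; rewrite Rabs_mult, Rabs_inv, (Rabs_pos_eq (INR (S p))) by lra.
    apply le_INR in Hp; rewrite plus_INR, S_INR in Hp; simpl (INR 1) in Hp.
    rewrite (Rabs_left1 (INR p - (INR n + al))) by lra.
    eapply Rle_trans; [|exact IH].
    replace (Rabs (binc (INR n + al) p) * (- (INR p - (INR n + al)) * / INR (S p)) *
      (INR (S p) * INR (fact p)) * INR (fact (n + 1 - S p))) with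
      (Rabs (binc (INR n + al) p) * INR (fact p) * INR (fact (n + 1 - S p)) *
        (INR n + al - INR p)) by (field; lra).
    replace (Rabs (binc (INR n + al) p) * INR (fact p) *
      ((INR n + 1 - INR p) * INR (fact (n + 1 - S p)))) with
      (Rabs (binc (INR n + al) p) * INR (fact p) * INR (fact (n + 1 - S p)) *
        (INR n + 1 - INR p)) by ring.
    apply Rmult_le_compat_l; [|lra].
    repeat apply Rmult_le_pos; try apply pos_INR; apply Rabs_pos.
Qed.

Lemma binc_bound (n : nat) (al : R) (p : nat) : 0 < al < 1 -> (n + 1 <= p)%nat ->
  Rabs (binc (INR n + al) p) * Rpower (INR p) (INR n + al + 1) <=
  exp ((INR n + al) ^ 2 + INR n + al).
Proof.
  intros Hal Hp; pose proof (pos_INR n) as Hn.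
  set (b := INR n + al).
  induction Hp as [|p Hp IH].
  - assert (H1 : Rabs (binc b (n + 1)) <= 1).
    { pose proof (binc_fact_le n al Hal (n + 1)%nat (le_n _)) as H; fold b in H.
      rewrite Nat.sub_diag in H; simpl (fact 0) in H; simpl (INR 1) in H.
      rewrite Rmult_1_r in H.
      apply (Rmult_le_reg_r (INR (fact (n + 1)))); [apply INR_fact_lt_0 | lra]. }
    (* The constant of the theorem arises here: ln (n+1) <= n <= b, so the exponent (b+1) ln (n+1)
       is at most b^2 + b. *)
    assert (H2 : Rpower (INR (n + 1)) (b + 1) <= exp (b ^ 2 + INR n + al)).
    { unfold Rpower; rewrite plus_INR; simpl (INR 1).
      assert (HL : ln (INR n + 1) <= INR n).
      { rewrite <- (ln_exp (INR n)) at 2.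
        apply ln_le; [lra|]. rewrite Rplus_comm; apply exp_ineq1_le. }
      assert (HE : (b + 1) * ln (INR n + 1) <= b ^ 2 + INR n + al).
      { apply Rle_trans with ((b + 1) * b); [|unfold b; simpl; nra].
        apply Rmult_le_compat_l; unfold b; lra. }
      destruct HE as [HE|HE]; [left; now apply exp_increasing | right; now rewrite HE]. }
    pose proof (Rabs_pos (binc b (n + 1))); pose proof (Rpower_pos (INR (n + 1)) (b + 1)).
    nra.
  - eapply Rle_trans; [|exact IH].
    assert (Hp1 : INR n + 1 <= INR p).
    { apply le_INR in Hp; rewrite plus_INR in Hp; exact Hp. }
    assert (Hb : 0 < b < INR p) by (unfold b; lra).
    cbn [binc]; rewrite Rabs_mult, S_INR.
    rewrite (Rabs_pos_eq ((INR p - b) / (INR p + 1))) by (apply Rdiv_le_0_compat; lra).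
    (* For this [y], Bernoulli's lower bound with exponent b + 1 equals the ratio (p-b)/(p+1) of
       consecutive coefficients. *)
    set (y := INR p / (INR p + 1)).
    assert (Hy : 0 < y) by (apply Rdiv_lt_0_compat; lra).
    pose proof (Rpower_bernoulli_convex y (b + 1) Hy ltac:(lra)) as HB.
    replace (1 + (b + 1) * (y - 1)) with ((INR p - b) / (INR p + 1)) in HB
      by (unfold y; field; lra).
    assert (HR : Rpower (INR p) (b + 1) = Rpower y (b + 1) * Rpower (INR p + 1) (b + 1))
      by (rewrite Rpower_mult_distr by lra; f_equal; unfold y; field; lra).
    rewrite HR, Rmult_assoc.
    apply Rmult_le_compat_l; [apply Rabs_pos|].
    apply Rmult_le_compat_r; [left; apply Rpower_pos | exact HB].
Qed.

(** With b = n + al, b |C(b-1,N)| = (N-b) |C(b,N)| <= N |C(b,N)|; the factor N uses up one power of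
    N in [binc_bound]. *)
Lemma binc_tail_bound (n : nat) (al : R) (N : nat) : 0 < al < 1 -> (n + 1 <= N)%nat ->
  Rabs (binc (INR n + al - 1) N) <=
  exp ((INR n + al) ^ 2 + INR n + al) / ((INR n + al) * Rpower (INR N) (INR n + al)).
Proof.
  intros Hal HN; pose proof (pos_INR n) as Hn.
  pose proof (binc_bound n al N Hal HN) as HB.
  pose proof (binc_pred_order (INR n + al) N) as HP.
  apply le_INR in HN; rewrite plus_INR in HN; simpl (INR 1) in HN.
  set (b := INR n + al) in *.
  assert (Hb : 0 < b < INR N) by (unfold b; lra).
  set (X := exp (b ^ 2 + INR n + al)) in *.
  apply (f_equal Rabs) in HP; rewrite !Rabs_mult in HP.
  rewrite (Rabs_pos_eq b), (Rabs_left1 (b - INR N)) in HP by lra.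
  rewrite Rpower_plus, Rpower_1 in HB by lra.
  pose proof (Rpower_pos (INR N) b) as HR.
  apply (Rmult_le_reg_r (b * Rpower (INR N) b)); [apply Rmult_lt_0_compat; lra|].
  replace (X / (b * Rpower (INR N) b) * (b * Rpower (INR N) b)) with X
    by (field; lra).
  replace (Rabs (binc (b - 1) N) * (b * Rpower (INR N) b)) with
    (b * Rabs (binc (b - 1) N) * Rpower (INR N) b) by ring.
  rewrite HP.
  eapply Rle_trans; [|exact HB].
  replace (Rabs (binc b N) * (Rpower (INR N) b * INR N)) with
    (INR N * Rabs (binc b N) * Rpower (INR N) b) by ring.
  apply Rmult_le_compat_r; [lra|].
  apply Rmult_le_compat_r; [apply Rabs_pos | lra].
Qed.

(** * Sign, monotonicity and limit of the binomial remainder *)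

Lemma nondecreasing_of_derive (f df : R -> R) (u v : R) : u <= v ->
  (forall x, u <= x <= v -> is_derive f x (df x)) ->
  (forall x, u <= x <= v -> 0 <= df x) -> f u <= f v.
Proof.
  intros Huv Hd Hp.
  destruct (MVT_gen f u v df) as [c [Hc E]].
  - intros x Hx; apply Hd; rewrite Rmin_left, Rmax_right in Hx; lra.
  - intros x Hx; rewrite Rmin_left, Rmax_right in Hx by lra.
    apply continuity_pt_filterlim, (ex_derive_continuous f x).
    exists (df x); now apply Hd.
  - rewrite Rmin_left, Rmax_right in Hc by lra.
    specialize (Hp c Hc); nra.
Qed.

(* Meaningful for [u < 1] only: [Rpower 0 b = 1], so the value at [1] is not the limit. *)
Definition brem (b : R) (M : nat) (u : R) : R :=
  Rpower (1 - u) b - sum_f_R0 (fun p => binc b p * u ^ p) M.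

Lemma is_derive_Rpower_rev (t b s : R) : s < t ->
  is_derive (fun s => Rpower (t - s) b) s (- b * Rpower (t - s) (b - 1)).
Proof.
  intros Hs.
  replace (Rpower (t - s) (b - 1)) with (Rpower (t - s) b * / (t - s)).
  - unfold Rpower; auto_derive; [lra|]. fold (t - s); field; lra.
  - replace (b - 1) with (b + - (1)) by ring.
    rewrite Rpower_plus, Rpower_Ropp, Rpower_1 by lra; reflexivity.
Qed.

Lemma is_derive_sum_binc (b : R) (M : nat) (u : R) :
  is_derive (fun u => sum_f_R0 (fun p => binc (b + 1) p * u ^ p) (S M)) u
    (- (b + 1) * sum_f_R0 (fun p => binc b p * u ^ p) M).
Proof.
  induction M as [|M IH].
  - simpl; auto_derive; [easy|]. field.
  - apply (is_derive_ext (fun u => plus (sum_f_R0 (fun p => binc (b + 1) p * u ^ p) (S M))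
      (binc (b + 1) (S (S M)) * u ^ (S (S M))))); [reflexivity|].
    replace (- (b + 1) * sum_f_R0 (fun p => binc b p * u ^ p) (S M)) with
      (plus (- (b + 1) * sum_f_R0 (fun p => binc b p * u ^ p) M)
        (- (b + 1) * binc b (S M) * u ^ S M)) by (cbn [sum_f_R0]; unfold plus; simpl; ring).
    apply @is_derive_plus; [exact IH|].
    rewrite <- binc_succ_order.
    generalize (binc (b + 1) (S (S M))); intros c.
    rewrite (Rmult_comm (INR _)), Rmult_assoc.
    apply (is_derive_scal (fun u => u ^ S (S M)) u c).
    apply is_derive_Reals, (derivable_pt_lim_pow u (S (S M))).
Qed.

(** The constant term of the truncated series drops out, so the exponent and the degree fall
    together. *)
Lemma is_derive_brem (b : R) (M : nat) (u : R) : u < 1 ->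
  is_derive (brem (b + 1) (S M)) u (- (b + 1) * brem b M u).
Proof.
  intros Hu; unfold brem; rewrite Rmult_minus_distr_l.
  apply @is_derive_minus; [|apply is_derive_sum_binc].
  pose proof (is_derive_Rpower_rev 1 (b + 1) u Hu) as H.
  replace (b + 1 - 1) with b in H by ring; exact H.
Qed.

Lemma brem_at_0 (b : R) (M : nat) : brem b M 0 = 0.
Proof.
  unfold brem.
  rewrite Rminus_0_r; unfold Rpower; rewrite ln_1, Rmult_0_r, exp_0.
  induction M as [|M IH]; cbn [sum_f_R0]; [simpl; ring|].
  rewrite pow_ne_zero by lia; lra.
Qed.

(** Induction on the degree with [b] general: the remainder vanishes at 0 and its derivative is -b
    times a remainder with a still more negative exponent. At degree 0 the claim is (1-u)^b >= 1. *)
Lemma brem_nonneg (M : nat) : forall (b u : R), b < 0 -> 0 <= u < 1 -> 0 <= brem b M u.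
Proof.
  induction M as [|M IH]; intros b u Hb Hu.
  - unfold brem; simpl.
    assert (1 <= Rpower (1 - u) b).
    { unfold Rpower; rewrite <- exp_0 at 1.
      assert (HL : ln (1 - u) <= 0) by (rewrite <- ln_1; apply ln_le; lra).
      assert (HE : 0 <= b * ln (1 - u)) by nra.
      destruct HE as [HE|HE]; [left; now apply exp_increasing | right; now rewrite <- HE]. }
    lra.
  - rewrite <- (brem_at_0 b (S M)).
    apply (nondecreasing_of_derive _ (fun u => - b * brem (b - 1) M u)); [lra| |].
    + intros v Hv; pose proof (is_derive_brem (b - 1) M v) as H.
      replace (b - 1 + 1) with b in H by ring; apply H; lra.
    + intros v Hv; apply Rmult_le_pos; [lra|]. apply IH; lra.
Qed.

(** The derivative brings in the negative factor -(b+1), which the additional factor -1 in the sign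
    compensates. *)
Lemma brem_mono_step (b : R) (M k : nat) : 0 < b + 1 ->
  (forall u, 0 <= u < 1 -> 0 <= (-1) ^ k * brem b M u) ->
  forall u v, 0 <= u -> u <= v -> v < 1 ->
  (-1) ^ S k * brem (b + 1) (S M) u <= (-1) ^ S k * brem (b + 1) (S M) v.
Proof.
  intros Hb H u v Hu Huv Hv.
  apply (nondecreasing_of_derive (fun u => (-1) ^ S k * brem (b + 1) (S M) u)
    (fun u => (-1) ^ S k * (- (b + 1) * brem b M u))); [exact Huv| |].
  - intros w Hw; apply (is_derive_scal (brem (b + 1) (S M)) w ((-1) ^ S k)).
    apply is_derive_brem; lra.
  - intros w Hw; replace ((-1) ^ S k * (- (b + 1) * brem b M w)) with
      ((b + 1) * ((-1) ^ k * brem b M w)) by (simpl; ring).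
    apply Rmult_le_pos; [lra|]. apply H; lra.
Qed.

Lemma brem_sign (al : R) (M k : nat) : 0 < al < 1 ->
  forall u, 0 <= u < 1 -> 0 <= (-1) ^ k * brem (al - 1 + INR k) (M + k) u.
Proof.
  intros Hal; induction k as [|k IH]; intros u Hu.
  - rewrite Nat.add_0_r; simpl; rewrite Rplus_0_r, Rmult_1_l.
    apply brem_nonneg; lra.
  - rewrite Nat.add_succ_r, S_INR, <- Rplus_assoc.
    pose proof (pos_INR k).
    pose proof (brem_mono_step (al - 1 + INR k) (M + k) k ltac:(lra) IH 0 u) as Hm.
    rewrite brem_at_0, Rmult_0_r in Hm; apply Hm; lra.
Qed.

Lemma filterlim_Rpower_rev_0 (t b : R) : 0 < b ->
  filterlim (fun s => Rpower (t - s) b) (at_left t) (locally 0).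
Proof.
  intros Hb; apply filterlim_locally; intros eps.
  (* The radius eps^(1/b) is the distance at which the power equals [eps]. *)
  exists (mkposreal _ (Rpower_pos eps (/ b))); intros s Hs Hst.
  unfold ball in *; simpl in *; unfold AbsRing_ball, abs, minus, plus, opp in *; simpl in *.
  rewrite Rabs_left1 in Hs by lra.
  rewrite Ropp_0, Rplus_0_r, Rabs_pos_eq by (left; apply Rpower_pos).
  replace (pos eps) with (Rpower (Rpower eps (/ b)) b).
  - apply Rlt_Rpower_l; [exact Hb | lra].
  - rewrite Rpower_mult, Rinv_l, Rpower_1; [reflexivity | apply eps | lra].
Qed.

Lemma filterlim_at_left_continuous (f : R -> R) (t : R) :
  continuous f t -> filterlim f (at_left t) (locally (f t)).
Proof. intros H; eapply filterlim_filter_le_1; [apply filter_le_within | exact H]. Qed.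

Lemma filterlim_plus_R {T} (F : (T -> Prop) -> Prop) {FF : Filter F} (f g : T -> R) (l m : R) :
  filterlim f F (locally l) -> filterlim g F (locally m) ->
  filterlim (fun s => f s + g s) F (locally (l + m)).
Proof.
  intros Hf Hg; eapply filterlim_comp_2; [exact Hf | exact Hg | exact (filterlim_plus l m)].
Qed.

Lemma filterlim_mult_R {T} (F : (T -> Prop) -> Prop) {FF : Filter F} (f g : T -> R) (l m : R) :
  filterlim f F (locally l) -> filterlim g F (locally m) ->
  filterlim (fun s => f s * g s) F (locally (l * m)).
Proof.
  intros Hf Hg; eapply filterlim_comp_2; [exact Hf | exact Hg | exact (filterlim_mult l m)].
Qed.

Lemma filterlim_sum_f_R0 {T} (F : (T -> Prop) -> Prop) {FF : Filter F}
  (f : nat -> T -> R) (l : nat -> R) (m : nat) :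
  (forall k, (k <= m)%nat -> filterlim (f k) F (locally (l k))) ->
  filterlim (fun s => sum_f_R0 (fun k => f k s) m) F (locally (sum_f_R0 l m)).
Proof.
  intros H; induction m as [|m IH]; cbn [sum_f_R0]; [now apply H|].
  apply (filterlim_plus_R F); [apply IH; intros k Hk; apply H; lia | now apply H].
Qed.

(** A positive exponent makes the power vanish at 1, so only the polynomial remains. *)
Lemma filterlim_brem (b : R) (M : nat) : 0 < b ->
  filterlim (brem b M) (at_left 1) (locally (- sum_f_R0 (binc b) M)).
Proof.
  intros Hb; unfold brem, Rminus.
  rewrite <- (Rplus_0_l (- _)).
  apply (filterlim_plus_R (at_left 1)); [now apply (filterlim_Rpower_rev_0 1)|].
  eapply filterlim_comp; [|apply (filterlim_opp (sum_f_R0 (binc b) M))].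
  apply (filterlim_sum_f_R0 (at_left 1) (fun p u => binc b p * u ^ p)).
  intros p _.
  pose proof (filterlim_at_left_continuous (fun u => binc b p * u ^ p) 1) as H.
  cbv beta in H; rewrite pow1, Rmult_1_r in H; apply H.
  apply (ex_derive_continuous (fun u : R => binc b p * u ^ p)); auto_derive; easy.
Qed.

Lemma brem_abs_le (n : nat) (al : R) (M : nat) (u : R) : 0 < al < 1 -> 0 <= u < 1 ->
  Rabs (brem (INR n + al) (M + S n) u) <= Rabs (binc (INR n + al - 1) (M + S n)).
Proof.
  intros Hal Hu; pose proof (pos_INR n).
  (* The sign and monotonicity lemmas count unit steps up from the negative exponent al - 1. *)
  replace (INR n + al) with (al - 1 + INR n + 1) by ring.
  rewrite <- sum_binc by lra.
  (* The sign makes [s] nonnegative and nondecreasing without changing absolute values, so [s u] is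
     at most the left limit of [s] at 1. *)
  set (s := fun v => (-1) ^ S n * brem (al - 1 + INR n + 1) (M + S n) v).
  assert (Habs : forall y, Rabs ((-1) ^ S n * y) = Rabs y).
  { intros y; rewrite Rabs_mult, pow_1_abs; ring. }
  rewrite <- (Habs (brem _ _ _)), <- (Rabs_Ropp (sum_f_R0 _ _)), <- (Habs (- _)).
  rewrite Rabs_pos_eq.
  2:{ pose proof (brem_sign al M (S n) Hal u Hu) as Hs.
      rewrite S_INR, <- Rplus_assoc in Hs; exact Hs. }
  eapply Rle_trans; [|apply Rle_abs].
  apply (filterlim_le (F := at_left 1) (fun _ => s u) s (s u)
    ((-1) ^ S n * - sum_f_R0 (binc (al - 1 + INR n + 1)) (M + S n))).
  - exists (mkposreal (1 - u) ltac:(lra)); intros v Hv Hv1.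
    unfold ball in Hv; simpl in Hv; unfold AbsRing_ball, abs, minus, plus, opp in Hv;
      simpl in Hv.
    rewrite Rabs_left1 in Hv by lra.
    unfold s; rewrite Nat.add_succ_r.
    apply brem_mono_step; try lra.
    now apply brem_sign.
  - apply filterlim_const.
  - apply (filterlim_mult_R (at_left 1)); [apply filterlim_const | apply filterlim_brem; lra].
Qed.

Lemma filterlim_rescale_at_left (a t : R) : a < t ->
  filterlim (fun s => (s - a) / (t - a)) (at_left t) (at_left 1).
Proof.
  intros Hat P [eps HP].
  assert (He : 0 < eps * (t - a)) by (apply Rmult_lt_0_compat; [apply eps | lra]).
  exists (mkposreal _ He); intros s Hs Hst.
  assert (E : 1 - (s - a) / (t - a) = (t - s) / (t - a)) by (field; lra).
  assert (H0 : 0 < (t - s) / (t - a)) by (apply Rdiv_lt_0_compat; lra).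
  apply HP; [|lra].
  unfold ball in *; simpl in *; unfold AbsRing_ball, abs, minus, plus, opp in *; simpl in *.
  rewrite Rabs_left1 in * by lra.
  replace (- ((s - a) / (t - a) + - (1))) with ((t - s) / (t - a)) by lra.
  apply (Rmult_lt_reg_r (t - a)); [lra|].
  replace ((t - s) / (t - a) * (t - a)) with (t - s) by (field; lra); lra.
Qed.

(** * Improper integral of the Abel kernel *)

Lemma is_derive_RInt_left (f : R -> R) (a t s : R) : a < t -> s < t ->
  (forall tau, tau < t -> continuous f tau) ->
  is_derive (RInt f a) s (f s).
Proof.
  intros Hat Hst Hf.
  apply (is_derive_RInt f (RInt f a) a s); [|now apply Hf].
  exists (mkposreal (t - s) ltac:(lra)); intros v Hv.
  apply (RInt_correct f), (ex_RInt_continuous f); intros z Hz; apply Hf.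
  unfold ball in Hv; simpl in Hv; unfold AbsRing_ball, abs, minus, plus, opp in Hv;
    simpl in Hv.
  apply Rabs_def2 in Hv.
  assert (Rmax a v < t) by (apply Rmax_lub_lt; lra). lra.
Qed.

Lemma abel_kernel_increment (y : R -> R) (al a t M s s' : R) :
  0 < al < 1 -> (forall tau, continuous y tau) -> a < t ->
  (forall tau, a <= tau <= t -> Rabs (y tau) <= M) ->
  a <= s -> s <= s' -> s' < t ->
  let g := RInt (fun tau => Rpower (t - tau) (al - 1) * y tau) a in
  Rabs (g s' - g s) <= M / al * Rpower (t - s) al.
Proof.
  intros Hal Hy Hat HM Has Hss Hst g.
  set (f := fun tau => Rpower (t - tau) (al - 1) * y tau) in *.
  assert (HM0 : 0 <= M)
    by (eapply Rle_trans; [apply Rabs_pos | apply (HM a); lra]).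
  assert (Hc : forall tau, tau < t -> continuous f tau).
  { intros tau Htau; apply (continuous_mult (fun tau => Rpower (t - tau) (al - 1)) y);
      [|apply Hy].
    apply (ex_derive_continuous (fun tau : R => Rpower (t - tau) (al - 1))); eexists;
      now apply is_derive_Rpower_rev. }
  (* Taking e = 1 and e = -1 gives both bounds. The function -(M/al) (t-s)^al has derivative M
     (t-s)^(al-1), which dominates the derivative of e g. *)
  assert (Hkey : forall e, e * e = 1 -> e * (g s' - g s) <= M / al * Rpower (t - s) al).
  { intros e He.
    assert (Hmono : - (M / al) * Rpower (t - s) al - e * g s <=
      - (M / al) * Rpower (t - s') al - e * g s').
    { apply (nondecreasing_of_derive
        (fun s => - (M / al) * Rpower (t - s) al - e * g s)
        (fun s => Rpower (t - s) (al - 1) * (M - e * y s))); [exact Hss| |].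
      - intros w Hw.
        replace (Rpower (t - w) (al - 1) * (M - e * y w)) with
          (minus (- (M / al) * (- al * Rpower (t - w) (al - 1))) (e * f w))
          by (unfold f, minus, plus, opp; simpl; field; lra).
        apply @is_derive_minus; apply is_derive_scal.
        + apply is_derive_Rpower_rev; lra.
        + apply (is_derive_RInt_left f a t); [exact Hat | lra | exact Hc].
      - intros w Hw; apply Rmult_le_pos; [left; apply Rpower_pos|].
        assert (Hyw : Rabs (e * y w) <= M).
        { rewrite Rabs_mult.
          replace (Rabs e) with 1; [rewrite Rmult_1_l; apply HM; lra|].
          symmetry; rewrite <- sqrt_Rsqr_abs; unfold Rsqr; rewrite He; apply sqrt_1. }
        pose proof (Rle_abs (e * y w)); lra. }
    assert (0 <= M / al * Rpower (t - s') al).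
    { apply Rmult_le_pos; [apply Rdiv_le_0_compat; lra | left; apply Rpower_pos]. }
    lra. }
  pose proof (Hkey 1 ltac:(ring)); pose proof (Hkey (-1) ltac:(ring)).
  apply Rabs_le; lra.
Qed.

(** Cauchy's criterion: the increment bound tends to 0 as its left endpoint tends to [t]. *)
Lemma abel_integral_cv (y : R -> R) (al a t M : R) :
  0 < al < 1 -> (forall tau, continuous y tau) -> a < t ->
  (forall tau, a <= tau <= t -> Rabs (y tau) <= M) ->
  exists l : R, filterlim (RInt (fun tau => Rpower (t - tau) (al - 1) * y tau) a)
    (at_left t) (locally l).
Proof.
  intros Hal Hy Hat HM.
  set (g := RInt (fun tau => Rpower (t - tau) (al - 1) * y tau) a).
  apply (filterlim_locally_cauchy (U := R_CompleteSpace) (F := at_left t)).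
  intros eps.
  exists (fun s => (a <= s < t) /\ M / al * Rpower (t - s) al < eps); split.
  - apply filter_and.
    + exists (mkposreal (t - a) ltac:(lra)); intros s Hs Hst.
      unfold ball in Hs; simpl in Hs; unfold AbsRing_ball, abs, minus, plus, opp in Hs;
        simpl in Hs.
      rewrite Rabs_left1 in Hs by lra; lra.
    + assert (HL : filterlim (fun s => M / al * Rpower (t - s) al) (at_left t)
        (locally (M / al * 0))).
      { apply (filterlim_mult_R (at_left t)); [apply filterlim_const|].
        apply filterlim_Rpower_rev_0; lra. }
      rewrite Rmult_0_r in HL; apply filterlim_locally with (eps := eps) in HL.
      revert HL; apply filter_imp; intros s Hs.
      unfold ball in Hs; simpl in Hs; unfold AbsRing_ball, abs, minus, plus, opp in Hs;
        simpl in Hs.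
      apply Rabs_def2 in Hs; lra.
  - intros u v [Hu Hue] [Hv Hve].
    unfold ball; simpl; unfold AbsRing_ball, abs, minus, plus, opp; simpl.
    destruct (Rle_dec u v) as [H|H].
    + eapply Rle_lt_trans; [|exact Hue].
      apply (abel_kernel_increment y al a t M u v); tauto || lra.
    + eapply Rle_lt_trans; [|exact Hve].
      replace (g v + - g u) with (- (g u - g v)) by ring; rewrite Rabs_Ropp.
      apply (abel_kernel_increment y al a t M v u); tauto || lra.
Qed.

(** Allows a function controlled only on the interval to be replaced by an extension [g] with good
    properties on a larger set. *)
Lemma Riemann_integrable_RInt (f g : R -> R) (a s : R) : a <= s ->
  (forall tau, a <= tau <= s -> f tau = g tau) -> ex_RInt g a s ->
  exists pr : Riemann_integrable f a s, RiemannInt pr = RInt g a s.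
Proof.
  intros Has E Hg.
  assert (E' : forall tau, Rmin a s < tau < Rmax a s -> f tau = g tau).
  { intros tau Ht; rewrite Rmin_left, Rmax_right in Ht by lra; apply E; lra. }
  assert (Hf : ex_RInt f a s).
  { apply (ex_RInt_ext g); [|exact Hg]. intros; symmetry; now apply E'. }
  exists (ex_RInt_Reals_0 f a s Hf).
  rewrite <- RInt_Reals; now apply RInt_ext.
Qed.

Lemma Rint_eq_RInt (f g : R -> R) (a s : R) : a <= s ->
  (forall tau, a <= tau <= s -> f tau = g tau) -> ex_RInt g a s ->
  Rint f a s = RInt g a s.
Proof.
  intros Has E Hg.
  assert (Hs : exists pr : Riemann_integrable f a s, RiemannInt pr = Rint f a s).
  { unfold Rint; apply epsilon_spec.
    exists (RInt g a s); now apply Riemann_integrable_RInt. }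
  destruct Hs as [pr <-]; rewrite <- RInt_Reals.
  apply RInt_ext; intros tau Ht; rewrite Rmin_left, Rmax_right in Ht by lra; apply E; lra.
Qed.

(** Existence of some limit for [g] makes the [epsilon] term satisfy its specification, which is
    then translated back into a filter limit. *)
Lemma improper_int_filterlim (f g : R -> R) (a t : R) : a < t ->
  (forall tau, a <= tau < t -> f tau = g tau) ->
  (forall tau, tau < t -> continuous g tau) ->
  (exists l : R, filterlim (RInt g a) (at_left t) (locally l)) ->
  filterlim (RInt g a) (at_left t) (locally (improper_int f a t)).
Proof.
  intros Hat E Hc [l Hl].
  assert (Hex : forall s, a <= s < t -> ex_RInt g a s).
  { intros s Hs; apply (ex_RInt_continuous g); intros z Hz; apply Hc.
    rewrite Rmax_right in Hz; lra. }
  assert (HI : improper_int_limit f a t (improper_int f a t)).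
  { unfold improper_int; apply epsilon_spec; exists l.
    intros eps He.
    apply filterlim_locally with (eps := mkposreal eps He) in Hl.
    destruct Hl as [d Hd].
    exists d; split; [apply d|]. intros s Hs Hds.
    destruct (Riemann_integrable_RInt f g a s) as [pr Hpr];
      [lra | intros; apply E; lra | apply Hex; lra |].
    exists pr; rewrite Hpr.
    apply (Hd s); [|lra].
    unfold ball; simpl; unfold AbsRing_ball, abs, minus, plus, opp; simpl.
    rewrite Rabs_left1; lra. }
  apply filterlim_locally; intros eps.
  destruct (HI eps (cond_pos eps)) as [d [Hd H]].
  exists (mkposreal (Rmin d (t - a)) ltac:(apply Rmin_pos; lra)); intros s Hs Hst.
  unfold ball in *; simpl in *; unfold AbsRing_ball, abs, minus, plus, opp in *; simpl in *.
  rewrite Rabs_left1 in Hs by lra.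
  pose proof (Rmin_l d (t - a)); pose proof (Rmin_r d (t - a)).
  destruct (H s ltac:(lra) ltac:(lra)) as [pr Hpr].
  rewrite <- RInt_Reals in Hpr.
  rewrite <- (RInt_ext f g); [exact Hpr|].
  intros tau Ht; rewrite Rmin_left, Rmax_right in Ht by lra; apply E; lra.
Qed.

(** * Extension of functions given on [a,b] *)

(** Composition with this projection onto [a,b] turns the one-sided notions at the endpoints into
    continuity on the whole line, and leaves derivatives inside the interval unchanged. *)
Definition clamp (a b s : R) : R := Rmax a (Rmin b s).

Lemma clamp_in (a b s : R) : a <= b -> a <= clamp a b s <= b.
Proof.
  intros H; unfold clamp; split; [apply Rmax_l|].
  apply Rmax_lub; [exact H | apply Rmin_l].
Qed.

Lemma clamp_id (a b s : R) : a <= s <= b -> clamp a b s = s.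
Proof. intros H; unfold clamp; rewrite Rmin_right, Rmax_right; lra. Qed.

Lemma clamp_dist (a b s s' : R) :
  Rabs (clamp a b s - clamp a b s') <= Rabs (s - s').
Proof.
  unfold clamp, Rmax, Rmin, Rabs.
  repeat destruct Rle_dec; repeat destruct Rcase_abs; lra.
Qed.

Lemma cont_within_clamp (a b : R) (f : R -> R) : a <= b ->
  (forall tau, a <= tau <= b -> cont_within a b f tau) ->
  forall s, continuous (fun s => f (clamp a b s)) s.
Proof.
  intros Hab H s; apply filterlim_locally; intros eps.
  destruct (H (clamp a b s) (clamp_in a b s Hab) eps (cond_pos eps)) as [d [Hd HD]].
  exists (mkposreal d Hd); intros s' Hs'.
  apply HD; [|now apply clamp_in].
  eapply Rle_lt_trans; [apply clamp_dist | exact Hs'].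
Qed.

Lemma deriv_within_cont (a b : R) (f : R -> R) (tau l : R) :
  deriv_within a b f tau l -> cont_within a b f tau.
Proof.
  intros H eps He.
  destruct (H 1 Rlt_0_1) as [d [Hd HD]].
  pose proof (Rabs_pos l) as Hl.
  (* Within distance [d] the difference quotient is smaller than |l| + 1 in absolute value. *)
  exists (Rmin d (eps / (Rabs l + 1))); split.
  { apply Rmin_pos; [exact Hd | apply Rdiv_lt_0_compat; lra]. }
  intros s Hs Hab.
  destruct (Req_dec s tau) as [->|Hne]; [rewrite Rminus_diag, Rabs_R0; lra|].
  pose proof (Rmin_l d (eps / (Rabs l + 1))); pose proof (Rmin_r d (eps / (Rabs l + 1))).
  set (h := s - tau) in *.
  assert (Hh : 0 < Rabs h) by (apply Rabs_pos_lt; unfold h; lra).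
  replace s with (tau + h) in Hab |- * by (unfold h; ring).
  specialize (HD h ltac:(unfold h; lra) ltac:(lra) Hab).
  set (q := (f (tau + h) - f tau) / h) in *.
  assert (Hq : Rabs q < Rabs l + 1).
  { replace q with (q - l + l) by ring.
    eapply Rle_lt_trans; [apply Rabs_triang | lra]. }
  replace (f (tau + h) - f tau) with (q * h) by (unfold q; field; unfold h; lra).
  rewrite Rabs_mult.
  apply Rlt_le_trans with ((Rabs l + 1) * (eps / (Rabs l + 1)));
    [|right; field; lra].
  apply Rmult_le_0_lt_compat; try lra; apply Rabs_pos.
Qed.

Lemma deriv_within_clamp (a b : R) (f : R -> R) (tau l : R) : a < tau < b ->
  deriv_within a b f tau l -> is_derive (fun s => f (clamp a b s)) tau l.
Proof.
  intros Ht H.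
  assert (Hr : 0 < Rmin (tau - a) (b - tau)) by (apply Rmin_pos; lra).
  pose proof (Rmin_l (tau - a) (b - tau)); pose proof (Rmin_r (tau - a) (b - tau)).
  apply is_derive_Reals; intros eps He.
  destruct (H eps He) as [d [Hd HD]].
  assert (Hm : 0 < Rmin d (Rmin (tau - a) (b - tau))) by (apply Rmin_pos; lra).
  exists (mkposreal _ Hm); simpl; intros h Hh0 Hh.
  pose proof (Rmin_l d (Rmin (tau - a) (b - tau)));
    pose proof (Rmin_r d (Rmin (tau - a) (b - tau))).
  assert (Hh' : Rabs h < Rmin (tau - a) (b - tau)) by lra.
  apply Rabs_def2 in Hh'.
  rewrite !clamp_id by lra.
  apply HD; [exact Hh0 | lra | lra].
Qed.

Lemma continuous_bounded (f : R -> R) (a b : R) : a <= b ->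
  (forall s, continuous f s) -> exists M, forall s, a <= s <= b -> Rabs (f s) <= M.
Proof.
  intros Hab Hf.
  destruct (continuity_ab_maj (fun s => Rabs (f s)) a b Hab) as [m [Hm _]].
  - intros s Hs; apply continuity_pt_filterlim.
    apply (continuous_comp f Rabs); [apply Hf | apply continuous_Rabs].
  - now exists (Rabs (f m)).
Qed.

(** The bound [M] ensures that a supremum exists, so that [epsilon] selects it. *)
Lemma max_abs_on_ub (f : R -> R) (a t M : R) : a <= t ->
  (forall s, a <= s <= t -> Rabs (f s) <= M) ->
  forall s, a <= s <= t -> Rabs (f s) <= max_abs_on f a t.
Proof.
  intros Hat HM s Hs.
  assert (HL : is_lub (fun y => exists tau, a <= tau <= t /\ y = Rabs (f tau))
    (max_abs_on f a t)).
  { unfold max_abs_on; apply epsilon_spec.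
    destruct (completeness (fun y => exists tau, a <= tau <= t /\ y = Rabs (f tau)))
      as [m Hm].
    - exists M; intros y [tau [Ht ->]]; now apply HM.
    - exists (Rabs (f a)), a; split; [lra | reflexivity].
    - now exists m. }
  apply HL; now exists s.
Qed.

(** * Repeated integration by parts *)

(* [kern al a t M (S k)] is the antiderivative of [- kern al a t M k] vanishing at [a];
   [kern al a t M 0] is the fractional kernel minus its truncated expansion. *)
Definition kern (al a t : R) (M k : nat) (s : R) : R :=
  Rpower (t - a) (al - 1 + INR k) / Gamma (al + INR k) *
  brem (al - 1 + INR k) (M + k) ((s - a) / (t - a)).

(** The factor al + k from the functional equation cancels the one from [is_derive_brem], and the
    inner derivative 1/(t-a) lowers the power of t - a. *)
Lemma is_derive_kern (al a t : R) (M k : nat) (s : R) : 0 < al < 1 -> a < t -> s < t ->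
  is_derive (kern al a t M (S k)) s (- kern al a t M k s).
Proof.
  intros Hal Hat Hst; pose proof (pos_INR k) as Hk.
  destruct (Gamma_pos_unit_shift al k Hal) as [Hok Hpos].
  unfold kern; rewrite Nat.add_succ_r, S_INR, <- !Rplus_assoc.
  rewrite (Gamma_succ (al + INR k) Hok).
  set (b := al - 1 + INR k).
  set (g := Gamma (al + INR k)) in *.
  set (u := (s - a) / (t - a)).
  assert (Hu : u < 1).
  { assert (E : 1 - u = (t - s) / (t - a)) by (unfold u; field; lra).
    assert (0 < (t - s) / (t - a)) by (apply Rdiv_lt_0_compat; lra). lra. }
  rewrite Rpower_plus, Rpower_1 by lra.
  replace (- (Rpower (t - a) b / g * brem b (M + k) u)) with
    (Rpower (t - a) b * (t - a) / ((al + INR k) * g) *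
      (/ (t - a) * (- (b + 1) * brem b (M + k) u)))
    by (unfold b; field; repeat split; lra).
  apply (is_derive_scal (fun s => brem (b + 1) (S (M + k)) ((s - a) / (t - a)))).
  apply (is_derive_comp (brem (b + 1) (S (M + k))) (fun s => (s - a) / (t - a))).
  - now apply is_derive_brem.
  - auto_derive; [easy | field; lra].
Qed.

Lemma kern_at_a (al a t : R) (M k : nat) : a < t -> kern al a t M k a = 0.
Proof.
  intros Hat; unfold kern.
  replace ((a - a) / (t - a)) with 0 by (field; lra).
  rewrite brem_at_0; ring.
Qed.

Lemma kern_0 (al a t : R) (M : nat) (s : R) : a < t -> s < t -> Gamma al <> 0 ->
  kern al a t M 0 s =
  / Gamma al * Rpower (t - s) (al - 1) -
  sum_f_R0 (fun i => Rpower (t - a) (al - 1) / Gamma al * (binc (al - 1) i / (t - a) ^ i) *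
    (s - a) ^ i) M.
Proof.
  intros Hat Hst HG; unfold kern, brem; simpl INR.
  rewrite !Rplus_0_r, Nat.add_0_r, Rmult_minus_distr_l, scal_sum; f_equal.
  - replace (t - s) with ((t - a) * (1 - (s - a) / (t - a))) by (field; lra).
    rewrite <- Rpower_mult_distr; [field; exact HG | lra|].
    replace (1 - (s - a) / (t - a)) with ((t - s) / (t - a)) by (field; lra).
    apply Rdiv_lt_0_compat; lra.
  - apply sum_eq; intros i _.
    unfold Rdiv at 1; rewrite Rpow_mult_distr, pow_inv.
    field; split; [|exact HG]. apply pow_nonzero; lra.
Qed.

(** These limits are the boundary values at [t]; up to sign they yield the A-terms. *)
Lemma filterlim_kern (al a t : R) (M k : nat) : 0 < al < 1 -> a < t ->
  filterlim (kern al a t M (S k)) (at_left t)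
    (locally (- (Rpower (t - a) (al + INR k) / Gamma (INR k + 1 + al) *
      sum_f_R0 (binc (INR k + al)) (M + S k)))).
Proof.
  intros Hal Hat; pose proof (pos_INR k) as Hk; unfold kern; rewrite S_INR.
  replace (al - 1 + (INR k + 1)) with (INR k + al) by ring.
  replace (al + (INR k + 1)) with (INR k + 1 + al) by ring.
  rewrite (Rplus_comm al), Ropp_mult_distr_r.
  apply (filterlim_mult_R (at_left t)); [apply filterlim_const|].
  eapply filterlim_comp; [now apply filterlim_rescale_at_left|].
  apply filterlim_brem; lra.
Qed.

Lemma kern_abs_le (al a t : R) (n M : nat) (s : R) : 0 < al < 1 -> a <= s < t ->
  Rabs (kern al a t M (S n) s) <=
  Rpower (t - a) (INR n + al) / Gamma (INR n + 1 + al) *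
  (exp ((INR n + al) ^ 2 + INR n + al) /
   ((INR n + al) * Rpower (INR (M + S n)) (INR n + al))).
Proof.
  intros Hal Hs; unfold kern.
  destruct (Gamma_pos_unit_shift al (S n) Hal) as [_ Hpos]; revert Hpos.
  rewrite S_INR.
  replace (al - 1 + (INR n + 1)) with (INR n + al) by ring.
  replace (al + (INR n + 1)) with (INR n + 1 + al) by ring.
  intros Hpos.
  assert (HC : 0 <= Rpower (t - a) (INR n + al) / Gamma (INR n + 1 + al))
    by (left; apply Rdiv_lt_0_compat; [apply Rpower_pos | exact Hpos]).
  rewrite Rabs_mult, (Rabs_pos_eq _ HC).
  apply Rmult_le_compat_l; [exact HC|].
  eapply Rle_trans; [apply brem_abs_le | apply binc_tail_bound; [exact Hal | lia]];
    [exact Hal|].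
  assert (E : 1 - (s - a) / (t - a) = (t - s) / (t - a)) by (field; lra).
  assert (0 < (t - s) / (t - a)) by (apply Rdiv_lt_0_compat; lra).
  assert (0 <= (s - a) / (t - a)) by (apply Rdiv_le_0_compat; lra).
  lra.
Qed.

(** The product rule telescopes over k; this is n + 1 integrations by parts in differential form. *)
Lemma is_derive_sum_parts (Q Y : nat -> R -> R) (n : nat) (s : R) :
  (forall k, (k <= n)%nat -> is_derive (Q (S k)) s (- Q k s)) ->
  (forall k, (k <= n)%nat -> is_derive (Y k) s (Y (S k) s)) ->
  is_derive (fun s => sum_f_R0 (fun k => Q (S k) s * Y k s) n) s
    (Q (S n) s * Y (S n) s - Q 0%nat s * Y 0%nat s).
Proof.
  intros HQ HY.
  assert (Hk : forall k, (k <= n)%nat -> is_derive (fun s => Q (S k) s * Y k s) s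
    (Q (S k) s * Y (S k) s - Q k s * Y k s)).
  { intros k Hk.
    replace (Q (S k) s * Y (S k) s - Q k s * Y k s) with
      (plus (mult (- Q k s) (Y k s)) (mult (Q (S k) s) (Y (S k) s)))
      by (unfold plus, mult; simpl; ring).
    apply (is_derive_mult (Q (S k)) (Y k)); [now apply HQ | now apply HY |].
    intros; apply Rmult_comm. }
  clear HQ HY; induction n as [|n IH]; [now apply (Hk 0%nat)|].
  apply (is_derive_ext (fun s => plus (sum_f_R0 (fun k => Q (S k) s * Y k s) n)
    (Q (S (S n)) s * Y (S n) s))); [reflexivity|].
  replace (Q (S (S n)) s * Y (S (S n)) s - Q 0%nat s * Y 0%nat s) with
    (plus (Q (S n) s * Y (S n) s - Q 0%nat s * Y 0%nat s)
      (Q (S (S n)) s * Y (S (S n)) s - Q (S n) s * Y (S n) s))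
    by (unfold plus; simpl; ring).
  apply @is_derive_plus; [apply IH; intros k Hkn; apply Hk; lia | apply Hk; lia].
Qed.

Lemma is_derive_sum_f_R0 (f df : nat -> R -> R) (m : nat) (s : R) :
  (forall k, is_derive (f k) s (df k s)) ->
  is_derive (fun s => sum_f_R0 (fun k => f k s) m) s (sum_f_R0 (fun k => df k s) m).
Proof.
  intros H; induction m as [|m IH]; cbn [sum_f_R0]; [apply H|].
  apply @is_derive_plus; [exact IH | apply H].
Qed.

Lemma continuity_pt_sum_f_R0 (f : nat -> R -> R) (m : nat) (s : R) :
  (forall k, (k <= m)%nat -> continuity_pt (f k) s) ->
  continuity_pt (fun s => sum_f_R0 (fun k => f k s) m) s.
Proof.
  intros H; induction m as [|m IH]; cbn [sum_f_R0]; [now apply H|].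
  apply continuity_pt_plus; [apply IH; intros k Hk; apply H; lia | now apply H].
Qed.

Lemma is_derive_continuity_pt (f : R -> R) (s l : R) : is_derive f s l -> continuity_pt f s.
Proof.
  intros H; apply continuity_pt_filterlim, (ex_derive_continuous f s); now exists l.
Qed.

(** The quantity inside the absolute value vanishes at [a] and has derivative
    [kern al a t M (S n) * Y (S n)], so the mean value theorem suffices. The bound is uniform in s <
    t and hence survives the passage to the limit. *)
Lemma remainder_bound (al a t : R) (n M : nat) (Y : nat -> R -> R) (L s : R) :
  0 < al < 1 -> a < s < t ->
  (forall k tau, (k <= n)%nat -> continuous (Y k) tau) ->
  (forall k tau, (k <= n)%nat -> a < tau < t -> is_derive (Y k) tau (Y (S k) tau)) ->
  (forall tau, a <= tau <= t -> Rabs (Y (S n) tau) <= L) ->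
  Rabs (/ Gamma al * RInt (fun tau => Rpower (t - tau) (al - 1) * Y 0%nat tau) a s -
    sum_f_R0 (fun i => Rpower (t - a) (al - 1) / Gamma al * (binc (al - 1) i / (t - a) ^ i) *
      RInt (fun tau => (tau - a) ^ i * Y 0%nat tau) a s) M +
    sum_f_R0 (fun k => kern al a t M (S k) s * Y k s) n) <=
  Rpower (t - a) (INR n + al) / Gamma (INR n + 1 + al) *
  (exp ((INR n + al) ^ 2 + INR n + al) /
   ((INR n + al) * Rpower (INR (M + S n)) (INR n + al))) * L * (t - a).
Proof.
  intros Hal Hs HYc HYd HL.
  set (C := Rpower (t - a) (INR n + al) / Gamma (INR n + 1 + al) *
    (exp ((INR n + al) ^ 2 + INR n + al) /
     ((INR n + al) * Rpower (INR (M + S n)) (INR n + al)))).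
  set (f := fun tau => Rpower (t - tau) (al - 1) * Y 0%nat tau).
  set (g := fun i tau => (tau - a) ^ i * Y 0%nat tau).
  set (w := fun i => Rpower (t - a) (al - 1) / Gamma al * (binc (al - 1) i / (t - a) ^ i)).
  set (J := fun s => / Gamma al * RInt f a s - sum_f_R0 (fun i => w i * RInt (g i) a s) M).
  set (P := fun s => sum_f_R0 (fun k => kern al a t M (S k) s * Y k s) n).
  change (Rabs (J s + P s) <= C * L * (t - a)).
  assert (HG : Gamma al <> 0) by (apply Gamma_neq_0, gamma_ok_unit, Hal).
  assert (Hfc : forall tau, tau < t -> continuous f tau).
  { intros tau Htau; apply (continuous_mult (fun tau => Rpower (t - tau) (al - 1)) (Y 0%nat));
      [|apply HYc; lia].
    apply (ex_derive_continuous (fun tau : R => Rpower (t - tau) (al - 1))); eexists;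
      now apply is_derive_Rpower_rev. }
  assert (Hgc : forall i tau, continuous (g i) tau).
  { intros i tau; apply (continuous_mult (fun tau => (tau - a) ^ i) (Y 0%nat));
      [|apply HYc; lia].
    apply (ex_derive_continuous (fun tau : R => (tau - a) ^ i)); auto_derive; easy. }
  assert (HJd : forall v, v < t -> is_derive J v (kern al a t M 0 v * Y 0%nat v)).
  { intros v Hv; rewrite kern_0 by (assumption || lra).
    replace ((/ Gamma al * Rpower (t - v) (al - 1) -
      sum_f_R0 (fun i => Rpower (t - a) (al - 1) / Gamma al * (binc (al - 1) i / (t - a) ^ i) *
        (v - a) ^ i) M) * Y 0%nat v) with
      (minus (/ Gamma al * f v) (sum_f_R0 (fun i => w i * g i v) M)).
    - apply @is_derive_minus.
      + apply (is_derive_scal (RInt f a)).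
        apply (is_derive_RInt_left f a t); [lra | exact Hv | exact Hfc].
      + apply (is_derive_sum_f_R0 (fun i s => w i * RInt (g i) a s) (fun i s => w i * g i s)).
        intros i; apply (is_derive_scal (RInt (g i) a)).
        apply (is_derive_RInt_left (g i) a t); [lra | exact Hv | intros; apply Hgc].
    - unfold minus, plus, opp, f; simpl.
      rewrite Rmult_minus_distr_r, (Rmult_comm _ (Y 0%nat v)), (Rmult_comm (sum_f_R0 _ _)).
      rewrite scal_sum.
      replace (sum_f_R0 (fun i => w i * g i v) M) with
        (sum_f_R0 (fun i => Rpower (t - a) (al - 1) / Gamma al *
          (binc (al - 1) i / (t - a) ^ i) * (v - a) ^ i * Y 0%nat v) M); [ring|].
      apply sum_eq; intros i _; unfold w, g; ring. }
  destruct (MVT_gen (fun s => J s + P s) a s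
    (fun s => kern al a t M (S n) s * Y (S n) s)) as [c [Hc E]].
  - intros v Hv; rewrite Rmin_left, Rmax_right in Hv by lra.
    replace (kern al a t M (S n) v * Y (S n) v) with
      (plus (kern al a t M 0 v * Y 0%nat v)
        (kern al a t M (S n) v * Y (S n) v - kern al a t M 0 v * Y 0%nat v))
      by (unfold plus; simpl; ring).
    apply @is_derive_plus; [apply HJd; lra|].
    apply (is_derive_sum_parts (kern al a t M) Y).
    + intros k _; apply is_derive_kern; lra.
    + intros k Hk; apply HYd; [exact Hk | lra].
  (* At the endpoint [a] the functions [Y k] are only known to be continuous, so the products are
     treated factor by factor. *)
  - intros v Hv; rewrite Rmin_left, Rmax_right in Hv by lra.
    apply (continuity_pt_plus J P).
    + eapply is_derive_continuity_pt, HJd; lra.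
    + apply (continuity_pt_sum_f_R0 (fun k s => kern al a t M (S k) s * Y k s)).
      intros k Hk; apply continuity_pt_mult.
      * eapply is_derive_continuity_pt, is_derive_kern; lra.
      * apply continuity_pt_filterlim, HYc, Hk.
  - rewrite Rmin_left, Rmax_right in Hc by lra.
    assert (HP0 : P a = 0).
    { unfold P; rewrite (sum_eq _ (fun _ => 0)); [now rewrite sum_cte, Rmult_0_l|].
      intros k _; rewrite kern_at_a by lra; ring. }
    assert (HJ0 : J a = 0).
    { unfold J; rewrite RInt_point.
      rewrite (sum_eq _ (fun _ => 0)); [rewrite sum_cte; unfold zero; simpl; ring|].
      intros k _; rewrite RInt_point; unfold zero; simpl; ring. }
    rewrite HP0, HJ0, Rplus_0_r, Rminus_0_r in E; rewrite E.
    rewrite !Rabs_mult, (Rabs_pos_eq (s - a)) by lra.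
    apply Rmult_le_compat; [|lra| |lra].
    + apply Rmult_le_pos; apply Rabs_pos.
    + apply Rmult_le_compat; [apply Rabs_pos | apply Rabs_pos | | apply HL; lra].
      apply kern_abs_le; [exact Hal | lra].
Qed.

(** * The coefficients A and B, and the expansion *)

Lemma coefA_binc (al : R) (n M k : nat) : 0 < al < 1 -> (k <= n)%nat ->
  coefA al n (M + S n) k = / Gamma (INR k + 1 + al) * sum_f_R0 (binc (INR k + al)) (M + S k).
Proof.
  intros Hal Hk; unfold coefA; f_equal.
  (* The 1 in the bracket is the term of index 0; since p - n = j + 1 - k, the term numbered j has
     index j + 1. *)
  rewrite (decomp_sum _ (M + S k)) by lia; f_equal.
  replace (pred (M + S k)) with (M + S n + k - n - 1)%nat by lia.
  apply sum_eq; intros j _; cbv zeta.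
  replace (Z.to_nat (Z.of_nat (n + 1) - Z.of_nat k + Z.of_nat j - Z.of_nat n + Z.of_nat k))
    with (S j) by lia.
  rewrite plus_IZR, minus_IZR, <- !INR_IZR_INZ, plus_INR.
  replace (INR n + INR 1 - INR k + INR j - INR n - al) with (INR (S j) - (INR k + al))
    by (rewrite S_INR; simpl; ring).
  pose proof (gamma_ok_neg_shift al k Hal) as Hok.
  replace (- al - INR k) with (- (INR k + al)) in * by ring.
  rewrite (proj2 (Gamma_binc (INR k + al) (S j) Hok)).
  field; split; [apply INR_fact_neq_0 | now apply Gamma_neq_0].
Qed.

(** The factor i + 1 split off from (k-n)! will cancel the factor k - n in [V]. *)
Lemma coefB_binc (al : R) (n i : nat) : 0 < al < 1 ->
  coefB al n (n + 1 + i) = binc (al - 1) i / (Gamma al * INR (S i)).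
Proof.
  intros Hal; unfold coefB.
  pose proof (gamma_ok_unit (1 - al) ltac:(lra)) as Hok.
  pose proof (Gamma_neq_0 _ Hok) as H1.
  pose proof (Gamma_neq_0 _ (gamma_ok_unit al Hal)) as H2.
  replace (n + 1 + i - n)%nat with (S i) by lia.
  replace (INR (n + 1 + i) - INR n - al) with (INR i - (al - 1))
    by (rewrite !plus_INR; simpl; ring).
  replace (1 - al) with (- (al - 1)) in * by ring.
  rewrite (proj2 (Gamma_binc (al - 1) i Hok)), fact_simpl, mult_INR.
  field; repeat split; try assumption; [apply not_0_INR; lia | apply INR_fact_neq_0].
Qed.

Theorem theorem3
  (a b : R) (alpha alpha' : R -> R) (n N : nat) (x : R -> R) (D : nat -> R -> R) :
  a < b ->
  (forall tau, a <= tau <= b -> 0 < alpha tau < 1) ->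
  (forall tau, a <= tau <= b -> deriv_within a b alpha tau (alpha' tau)) ->
  (forall tau, a <= tau <= b -> cont_within a b alpha' tau) ->
  (n + 1 <= N)%nat ->
  Cm_derivs a b (n + 1) x D ->
  forall t, a < t <= b ->
    let al := alpha t in
    let E := RL_int alpha x a t -
      Rpower (t - a) al *
      (sum_f_R0 (fun k => coefA al n N k * (t - a) ^ k * D k t) n +
       sum_f_R0 (fun i => let k := (n + 1 + i)%nat in
                   coefB al n k / (t - a) ^ (k - n) * V x a n k t)
                (N - (n + 1))) in
    Rabs E <=
      max_abs_on (D (n + 1)%nat) a t *
      exp ((INR n + al) ^ 2 + INR n + al) /
      (Gamma (INR n + 1 + al) * (INR n + al) * Rpower (INR N) (INR n + al)) *
      Rpower (t - a) (INR n + 1 + al).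
Proof.
  intros Hab Halpha _ _ HN [HD0 [HDd HDc]] t Ht al E.
  assert (Hal : 0 < al < 1) by (apply Halpha; lra).
  (* M = N - n - 1 is the degree at which the kernel expansion is truncated. *)
  assert (HM : exists M, N = (M + S n)%nat) by (exists (N - (n + 1))%nat; lia).
  destruct HM as [M ->]; clear HN.
  rewrite Nat.add_1_r in *.
  pose proof (Gamma_neq_0 _ (gamma_ok_unit al Hal)) as HG.
  pose proof (pos_INR n) as Hn.
  set (Y := fun k s => D k (clamp a b s)).
  assert (HYt : forall k s, a <= s <= b -> Y k s = D k s)
    by (intros k s Hs; unfold Y; now rewrite clamp_id).
  assert (HYc : forall k s, (k <= S n)%nat -> continuous (Y k) s).
  { intros k s Hk; apply (cont_within_clamp a b (D k)); [lra|].
    intros tau Htau.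
    destruct (Nat.eq_dec k (S n)) as [->|Hne]; [now apply HDc|].
    apply deriv_within_cont with (D (S k) tau); apply HDd; [lia | exact Htau]. }
  assert (HYd : forall k s, (k <= n)%nat -> a < s < t -> is_derive (Y k) s (Y (S k) s)).
  { intros k s Hk Hs; rewrite (HYt (S k)) by lra.
    apply deriv_within_clamp; [lra|]. apply HDd; [lia | lra]. }
  set (L := max_abs_on (D (S n)) a t).
  assert (HL : forall s, a <= s <= t -> Rabs (Y (S n) s) <= L).
  { destruct (continuous_bounded (Y (S n)) a t) as [B HB];
      [lra | intros; now apply HYc |].
    intros s Hs; rewrite HYt by lra; unfold L.
    apply max_abs_on_ub with B; [lra | | exact Hs].
    intros v Hv; rewrite <- HYt by lra; now apply HB. }
  assert (Hx : forall s, a <= s <= t -> x s = Y 0%nat s)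
    by (intros s Hs; rewrite HYt, HD0; lra).
  set (f := fun tau => Rpower (t - tau) (al - 1) * Y 0%nat tau).
  set (I := improper_int (fun tau => Rpower (t - tau) (al - 1) * x tau) a t).
  assert (HI : filterlim (RInt f a) (at_left t) (locally I)).
  { apply improper_int_filterlim; [lra | | |].
    - intros tau Htau; unfold f; rewrite Hx by lra; reflexivity.
    - intros tau Htau.
      apply (continuous_mult (fun tau => Rpower (t - tau) (al - 1)) (Y 0%nat));
        [|apply HYc; lia].
      apply (ex_derive_continuous (fun tau : R => Rpower (t - tau) (al - 1))); eexists;
        now apply is_derive_Rpower_rev.
    - destruct (continuous_bounded (Y 0%nat) a t) as [B HB];
        [lra | intros; apply HYc; lia |].
      apply (abel_integral_cv (Y 0%nat) al a t B); [exact Hal | | lra | exact HB].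
      intros; apply HYc; lia. }
  set (g := fun i tau => (tau - a) ^ i * Y 0%nat tau).
  assert (Hgc : forall i tau, continuous (g i) tau).
  { intros i tau; apply (continuous_mult (fun tau => (tau - a) ^ i) (Y 0%nat));
      [|apply HYc; lia].
    apply (ex_derive_continuous (fun tau : R => (tau - a) ^ i)); auto_derive; easy. }
  set (w := fun i => Rpower (t - a) (al - 1) / Gamma al * (binc (al - 1) i / (t - a) ^ i)).
  (* [q k] is the left limit at [t] of [kern al a t M (S k)]; times [Y k t] it is minus the k-th
     A-term. *)
  set (q := fun k => - (Rpower (t - a) (al + INR k) / Gamma (INR k + 1 + al) *
    sum_f_R0 (binc (INR k + al)) (M + S k))).
  assert (HE : E = / Gamma al * I + - sum_f_R0 (fun i => w i * RInt (g i) a t) M +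
    sum_f_R0 (fun k => q k * Y k t) n).
  { unfold E, RL_int; fold al; fold I.
    replace (M + S n - (n + 1))%nat with M by lia.
    rewrite Rmult_plus_distr_l, !scal_sum.
    assert (E1 : sum_f_R0 (fun k => coefA al n (M + S n) k * (t - a) ^ k * D k t *
      Rpower (t - a) al) n = - sum_f_R0 (fun k => q k * Y k t) n).
    { replace (- sum_f_R0 (fun k => q k * Y k t) n) with
        ((-1) * sum_f_R0 (fun k => q k * Y k t) n) by ring.
      rewrite scal_sum; apply sum_eq; intros k Hk.
      rewrite coefA_binc by assumption.
      unfold q; rewrite HYt, Rpower_plus, Rpower_pow by lra.
      unfold Rdiv; ring. }
    rewrite E1; clear E1.
    match goal with |- _ - (_ + ?X) = _ =>
      replace X with (sum_f_R0 (fun i => w i * RInt (g i) a t) M); [ring|] end.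
    symmetry; apply sum_eq.
    intros i _; cbv zeta.
    rewrite coefB_binc by exact Hal; unfold V.
    replace (n + 1 + i - n)%nat with (S i) by lia.
    replace (S i - 1)%nat with i by lia.
    rewrite (Rint_eq_RInt _ (g i)); [| lra | |].
    - unfold w.
      (* One factor t - a is split off because the B-term divides by (t-a)^(i+1) while [w i] has
         only (t-a)^i. *)
      replace (Rpower (t - a) al) with (Rpower (t - a) (al - 1) * (t - a)).
      + simpl pow; field; repeat split; try lra;
          [apply pow_nonzero; lra | apply not_0_INR; lia].
      + pose proof (Rpower_plus (al - 1) 1 (t - a)) as HR.
        rewrite Rpower_1 in HR by lra; rewrite <- HR; f_equal; ring.
    - intros tau Htau; unfold g; now rewrite Hx.
    - apply (ex_RInt_continuous (g i)); intros; apply Hgc. }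
  (* [F s] is the counterpart of [E] with upper limit s < t, where the kernel is still regular; [E]
     is its left limit at [t]. *)
  set (F := fun s => / Gamma al * RInt f a s + - sum_f_R0 (fun i => w i * RInt (g i) a s) M +
    sum_f_R0 (fun k => kern al a t M (S k) s * Y k s) n).
  assert (HF : filterlim F (at_left t) (locally E)).
  { rewrite HE; unfold F.
    repeat apply (filterlim_plus_R (at_left t)).
    - apply (filterlim_mult_R (at_left t)); [apply filterlim_const | exact HI].
    - eapply filterlim_comp; [|apply (filterlim_opp (sum_f_R0 _ M))].
      apply (filterlim_sum_f_R0 (at_left t) (fun i s => w i * RInt (g i) a s)).
      intros i _; apply (filterlim_mult_R (at_left t)); [apply filterlim_const|].
      apply (filterlim_at_left_continuous (RInt (g i) a)).
      apply (ex_derive_continuous (RInt (g i) a)); eexists.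
      (* The bound t + 1 places [t] strictly inside the range of the lemma; [g i] is continuous
         everywhere. *)
      apply (is_derive_RInt_left (g i) a (t + 1)); [lra | lra | intros; apply Hgc].
    - apply (filterlim_sum_f_R0 (at_left t) (fun k s => kern al a t M (S k) s * Y k s)).
      intros k Hk; apply (filterlim_mult_R (at_left t)).
      + apply filterlim_kern; [exact Hal | lra].
      + apply filterlim_at_left_continuous, HYc; lia. }
  set (C := Rpower (t - a) (INR n + al) / Gamma (INR n + 1 + al) *
    (exp ((INR n + al) ^ 2 + INR n + al) /
     ((INR n + al) * Rpower (INR (M + S n)) (INR n + al))) * L * (t - a)).
  destruct (Gamma_pos_unit_shift al (S n) Hal) as [_ HGn].
  replace (al + INR (S n)) with (INR n + 1 + al) in HGn by (rewrite S_INR; ring).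
  replace (L * exp ((INR n + al) ^ 2 + INR n + al) /
    (Gamma (INR n + 1 + al) * (INR n + al) * Rpower (INR (M + S n)) (INR n + al)) *
    Rpower (t - a) (INR n + 1 + al)) with C.
  2:{ unfold C; replace (INR n + 1 + al) with (INR n + al + 1) in * by ring.
      rewrite (Rpower_plus (INR n + al) 1), Rpower_1 by lra.
      pose proof (Rpower_pos (INR (M + S n)) (INR n + al)).
      field; repeat split; lra. }
  apply (filterlim_le (F := at_left t) (fun s => Rabs (F s)) (fun _ => C) (Rabs E) C).
  - exists (mkposreal (t - a) ltac:(lra)); intros s Hs Hst.
    unfold ball in Hs; simpl in Hs; unfold AbsRing_ball, abs, minus, plus, opp in Hs;
      simpl in Hs.
    rewrite Rabs_left1 in Hs by lra.
    apply (remainder_bound al a t n M Y L s); try assumption; [lra|].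
    intros k tau Hk; apply HYc; lia.
  - eapply filterlim_comp; [exact HF|]. apply (filterlim_Rabs E).
  - apply filterlim_const.
Qed.
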